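(* There is an absolute constant $c>0$ such that for every integer $p \ge 2$, every randomized non-preemptive online algorithm for $\textsc{Part}$ with parameter $p$ has expected competitive ratio at least $c\cdot p$ (i.e. $\Omega(p)$), and this holds even when the inputs are restricted to all-ones sequences.
   Context: $\textsc{Part}$: given an integer sequence $X=w_1,\dots,w_n$ of positive integers and an integer $p\ge 2$, choose separators $1=s_0\le s_1\le\dots\le s_{p-1}\le s_p=n+1$ so as to minimize the bottleneck value $\max_{0\le j\le p-1}\sum_{i=s_j}^{s_{j+1}-1} w_i$ (the maximum weight of one of the $p$ contiguous blocks). Non-preemptive online model: $p$ is known in advance, the integers $w_1,\dots,w_n$ arrive one by one ($n$ unknown), and upon receiving $w_i$ the algorithm irrevocably decides whether to place a separator after $w_i$; at most $p-1$ separators are placed. The competitive ratio of a deterministic algorithm is the maximum, over all inputs, of the ratio between the bottleneck value of its partitioning and the optimal bottleneck value; for a randomized algorithm one takes the maximum over inputs of the expected ratio (expectation over the algorithm's coin flips). *)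

(* Defs.v *)
From mathcomp Require Import all_boot all_order all_algebra.
From mathcomp Require Import all_classical all_reals all_analysis.
Set Implicit Arguments.
Unset Strict Implicit.
Unset Printing Implicit Defensive.
Import Order.TTheory GRing.Theory Num.Theory.

(* The empty sequence is excluded: its optimal bottleneck value is 0, so no
   ratio is defined for it. *)
Definition inputs : set (seq nat) :=
  [set w | w != [::] /\ all (fun x => 0 < x) w].

Definition all_ones : set (seq nat) :=
  [set w | exists2 n, 0 < n & w = nseq n 1].

(* s = [:: s_0; ...; s_p] with 1 = s_0 <= s_1 <= ... <= s_p = n + 1 *)
Definition is_separators (p n : nat) (s : seq nat) : bool :=
  [&& size s == p.+1, nth 0 s 0 == 1, nth 0 s p == n.+1 & sorted leq s].

(* Weights are numbered from 1: w_i is [nth 0 w i.-1]. *)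
Definition bottleneck (p : nat) (w s : seq nat) : nat :=
  \max_(j < p) \sum_(nth 0 s j <= i < nth 0 s j.+1) nth 0 w i.-1.

(* The neutral element [sumn w] is an upper bound on every bottleneck value;
   by [opt_attained] and [opt_le] below, [opt p w] is the minimum over all
   valid choices of separators whenever p > 0. *)
Definition opt (p : nat) (w : seq nat) : nat :=
  \big[minn/sumn w]_(s : p.+1.-tuple 'I_(size w).+2
      | is_separators p (size w) (map val s)) bottleneck p w (map val s).

(* Positions of the separators put down while reading w: a decision function
   f sees the prefix w_1, ..., w_i only, and a separator after w_i is a
   separator s_j = i + 1. *)
Definition placed (f : seq nat -> bool) (w : seq nat) : seq nat :=
  [seq i.+1 | i <- iota 1 (size w) & f (take i w)].

(* A deterministic algorithm. Its own earlier decisions are determined by the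
   prefix read so far, and so need not be arguments of [decide]. *)
Record det_alg (p : nat) := DetAlg {
  decide :> seq nat -> bool;
  decide_budget : forall w, inputs w -> size (placed decide w) <= p.-1 }.

(* Separators not used by the end of the input are put at n + 1, creating
   empty blocks. *)
Definition alg_separators (p : nat) (D : det_alg p) (w : seq nat) : seq nat :=
  1 :: placed D w ++ nseq (p - size (placed D w)) (size w).+1.

(* A randomized algorithm: T is the space of outcomes of the coin flips, and
   each fixed outcome yields a deterministic algorithm. *)
Record rand_alg (p : nat) (d : measure_display) (T : measurableType d) :=
  RandAlg {
    run :> T -> det_alg p;
    run_measurable : forall w, inputs w -> measurable [set t | run t w] }.

Definition ratio (R : realType) (p : nat) (D : det_alg p) (w : seq nat) : R :=
  ((bottleneck p w (alg_separators D w))%:R / (opt p w)%:R)%R.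

Definition competitive_ratio (R : realType) (p : nat) (d : measure_display)
    (T : measurableType d) (P : probability T R) (A : rand_alg p T)
    (I : set (seq nat)) : \bar R :=
  ereal_sup [set 'E_P[fun t => ratio R (A t) w]%E | w in I]%classic.

Lemma all_ones_inputs : (all_ones `<=` inputs)%classic.
Proof.
move=> w [n n0 ->]; split; first by case: n n0.
by rewrite all_nseq orbT.
Qed.

Lemma bottleneck_le_sumn p w s :
  is_separators p (size w) s -> bottleneck p w s <= sumn w.
Proof.
move=> /and4P[/eqP sz /eqP s0 /eqP sp so].
have mono i j : i <= j -> j <= p -> nth 0 s i <= nth 0 s j.
  move=> ij jp; apply: (sorted_leq_nth leq_trans leqnn) => //;
    by rewrite inE sz ltnS // (leq_trans ij).
have sumE : sumn w = \sum_(1 <= i < (size w).+1) nth 0 w i.-1.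
  by rewrite big_add1 /= sumnE (big_nth 0).
apply/bigmax_leqP => j _; rewrite sumE.
have h1 : 1 <= nth 0 s j by rewrite -{1}s0; apply: mono => //; exact: ltnW.
have h2 : nth 0 s j <= nth 0 s j.+1 by apply: mono.
have h3 : nth 0 s j.+1 <= (size w).+1 by rewrite -sp; apply: mono.
rewrite (big_cat_nat h1 (leq_trans h2 h3)) /= (big_cat_nat h2 h3) /=.
by rewrite addnCA leq_addr.
Qed.

Lemma alg_separatorsP p (D : det_alg p) w :
  0 < p -> inputs w -> is_separators p (size w) (alg_separators D w).
Proof.
move=> p0 iw; have := decide_budget D iw; rewrite /alg_separators.
set q := placed D w => qp.
have qp' : size q < p by rewrite -(prednK p0) ltnS.
have qs : sorted leq q.
  rewrite /q /placed sorted_map; apply: (sorted_filter (leT := leq)) => //.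
    exact: leq_trans.
  exact: iota_sorted.
have qb x : x \in q -> 1 <= x <= (size w).+1.
  move=> /mapP[i]; rewrite mem_filter mem_iota => /andP[_ /andP[_ +]] ->.
  by rewrite add1n !ltnS.
apply/and4P; split => //.
- by rewrite /= size_cat size_nseq subnKC // ltnW.
- rewrite -[X in nth _ _ X](prednK p0) /= nth_cat ltnNge qp /= nth_nseq.
  by rewrite ltn_sub2r // ltn_predL.
- rewrite /= path_sortedE; last exact: leq_trans.
  rewrite all_cat; apply/andP; split.
    rewrite all_nseq orbT andbT; apply/allP => x /qb /andP[]//.
  rewrite sorted_pairwise; last exact: leq_trans.
  rewrite pairwise_cat -sorted_pairwise ?qs /=; last exact: leq_trans.
  apply/andP; split.
    by apply/allrelP => x y /qb /andP[_ ?]; rewrite mem_nseq => /andP[_ /eqP->].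
  by elim: (p - _) => //= m ->; rewrite all_nseq leqnn orbT.
Qed.

Lemma opt_le p w s :
  is_separators p (size w) s -> opt p w <= bottleneck p w s.
Proof.
move=> ss; have /and4P[sz /eqP s0 /eqP sp so] := ss.
have b x : x \in s -> x < (size w).+2.
  move=> xs; rewrite ltnS -sp -[x](nth_index 0 xs).
  apply: (sorted_leq_nth leq_trans leqnn) => //;
    rewrite ?inE ?index_mem ?(eqP sz) //.
  by rewrite -ltnS -(eqP sz) index_mem.
pose t : p.+1.-tuple 'I_(size w).+2 :=
  Tuple (n := p.+1) (tval := map inord s) (introT eqP (etrans (size_map _ _) (eqP sz))).
have ts : map val t = s.
  by rewrite /= -map_comp map_id_in// => x /b xb; rewrite /= inordK.
rewrite /opt -big_filter -[X in _ <= bottleneck p w X]ts.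
set r := [seq _ <- _ | _].
have : t \in r by rewrite mem_filter mem_index_enum ts ss.
elim: r => // u r IH; rewrite inE big_cons => /predU1P[<-|/IH].
  exact: geq_minl.
by apply: leq_trans; exact: geq_minr.
Qed.

Lemma opt_attained p w : 0 < p ->
  exists2 s, is_separators p (size w) s & bottleneck p w s = opt p w.
Proof.
move=> p0; rewrite /opt.
pose Q m := exists2 s, is_separators p (size w) s & bottleneck p w s = m.
apply: (big_ind Q) => [|x y Qx Qy|s ss]; last by exists (map val s).
  pose s := 1 :: nseq p (size w).+1.
  have ss : is_separators p (size w) s.
    rewrite /s; apply/and4P; split => //; first by rewrite /= size_nseq.
      case: (p) p0 => // m _.
      by rewrite -[nth _ _ _]/(nth 0 (nseq m.+1 _) m) nth_nseq ltnSn.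
    by elim: (p) => //= -[|m] /= ih; rewrite ?leqnn.
  exists s => //; apply/eqP; rewrite eqn_leq bottleneck_le_sumn //=.
  rewrite /bottleneck; apply: (leq_trans _ (leq_bigmax (Ordinal p0))).
  by rewrite /s /= nth_nseq p0 big_add1 /= sumnE (big_nth 0).
by rewrite /minn; case: ifP.
Qed.

(* Main.v *)
Require Import Defs.
From mathcomp Require Import all_boot all_order all_algebra.
From mathcomp Require Import all_classical all_reals all_analysis.
From mathcomp Require Import measurable_realfun zify lra.
Set Implicit Arguments.
Unset Strict Implicit.
Unset Printing Implicit Defensive.
Import Order.TTheory GRing.Theory Num.Theory.

(** Feed the all-ones inputs of length [p * 2 ^ k.+1] for [k < 2 * p]. The
    intervals [(p * 2 ^ k, p * 2 ^ k.+1]] are disjoint, so the at most [p - 1]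
    separators of a deterministic algorithm miss more than half of them. On the
    length ending a missed interval the algorithm has a block of weight at least
    [p * 2 ^ k] while the optimum is at most [2 ^ k.+1], a ratio of at least
    [p / 2]. Hence, for every outcome of the coin flips, the ratios of the
    [2 * p] lengths sum to at least [p ^ 2 / 2]; taking expectations, some length
    has expected ratio at least [p / 4]. *)

Lemma nseq_inputs n : 0 < n -> inputs (nseq n 1).
Proof. by move=> n0; apply: all_ones_inputs; exists n. Qed.

Lemma sum_nth_ones a b n : 0 < a -> b <= n.+1 ->
  \sum_(a <= i < b) nth 0 (nseq n 1) i.-1 = b - a.
Proof.
move=> a0 bn; rewrite (@eq_big_nat _ _ _ a b _ (fun=> 1)).
  by rewrite sum_nat_const_nat muln1.
move=> i /andP[ai ib]; rewrite nth_nseq; case: ifP => //; lia.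
Qed.

(** This is the block containing the element numbered [m.+1]. Blocks may be empty, so it is found
    through the least index whose separator exceeds [m.+1]; minimality bounds the preceding
    separator. *)
Lemma block_around p n s m : is_separators p n s -> m < n ->
  exists j, [/\ j < p, 0 < nth 0 s j, nth 0 s j <= m.+1,
                m.+1 < nth 0 s j.+1 & nth 0 s j.+1 <= n.+1].
Proof.
move=> /and4P[/eqP sz /eqP s0 /eqP sp so] mn.
have mono i j : i <= j -> j <= p -> nth 0 s i <= nth 0 s j.
  move=> ij jp; apply: (sorted_leq_nth leq_trans leqnn) => //;
    by rewrite inE sz ltnS // (leq_trans ij).
have ex : exists j, m.+1 < nth 0 s j by exists p; rewrite sp.
have := find_ex_minn ex; case=> [[|j] hj jmin]; first by rewrite s0 in hj.
have jp : j < p by apply: jmin; rewrite sp.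
exists j; split => //.
- by rewrite -{1}s0; apply: mono => //; exact: ltnW.
- by rewrite leqNgt; apply/negP => /jmin; rewrite ltnn.
- by rewrite -sp mono.
Qed.

Lemma bottleneck_block p n s j : j < p -> 0 < nth 0 s j ->
  nth 0 s j.+1 <= n.+1 -> nth 0 s j.+1 - nth 0 s j <= bottleneck p (nseq n 1) s.
Proof.
move=> jp s0 sn; rewrite -(sum_nth_ones s0 sn).
exact: (leq_bigmax (F := fun j : 'I_p => _) (Ordinal jp)).
Qed.

Lemma opt_ones_gt0 p n : 0 < p -> 0 < n -> 0 < opt p (nseq n 1).
Proof.
move=> p0 n0; have [s + <-] := opt_attained (nseq n 1) p0.
rewrite size_nseq => /block_around/(_ n0)[j [jp s0 s1 s2 sn]].
by apply: leq_trans (bottleneck_block jp s0 sn); lia.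
Qed.

Lemma opt_ones_le p b : opt p (nseq (p * b) 1) <= b.
Proof.
(* Equal cutting: [p] blocks of exactly [b] ones. *)
pose s := [seq (j * b).+1 | j <- iota 0 p.+1].
have sE j : j <= p -> nth 0 s j = (j * b).+1.
  by move=> jp; rewrite (nth_map 0) ?size_iota ?ltnS // nth_iota.
have ss : is_separators p (size (nseq (p * b) 1)) s.
  rewrite size_nseq; apply/and4P; split.
  - by rewrite size_map size_iota.
  - by rewrite sE.
  - by rewrite sE.
  - apply: (homo_sorted (e := leq)); last exact: iota_sorted.
    by move=> x y xy; rewrite ltnS leq_mul2r xy orbT.
apply: leq_trans (opt_le ss) _; apply/bigmax_leqP => j _.
have jp := ltn_ord j.
rewrite sum_nth_ones !sE ?ltnS ?leq_mul2r ?jp ?(ltnW jp) ?orbT //.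
by rewrite subSS -mulnBl subSnn mul1n.
Qed.

(** A prefix of an all-ones input is determined by its length, so whether a separator follows one of
    the positions in [(m, n]] does not depend on the total length of the input. *)
Definition hits (f : seq nat -> bool) (m n : nat) : bool :=
  has (fun i => f (nseq i 1)) (iota m.+1 (n - m)).

Lemma bottleneck_ones_gap p (D : det_alg p) m n : 0 < p -> m <= n ->
  ~~ hits D m n ->
  n - m <= bottleneck p (nseq n 1) (alg_separators D (nseq n 1)).
Proof.
move=> p0; rewrite leq_eqVlt => /predU1P[->|mn gap]; first by rewrite subnn.
have := alg_separatorsP D p0 (nseq_inputs (leq_ltn_trans (leq0n m) mn)).
rewrite size_nseq; set s := alg_separators _ _ => ss.
(* A separator after position [i] has value [i.+1], so a gap on [(m, n]] leaves only values up to
   [m.+1] and the padding value [n.+1]. Hence the block around [m.+1] extends to the end of the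
   input. *)
have sP x : x \in s -> (x <= m.+1) || (n < x).
  rewrite inE mem_cat mem_nseq size_nseq => /or3P[/eqP->//|/mapP[i]|].
    rewrite mem_filter mem_iota size_nseq => /andP[fi /andP[i1 iN]] ->.
    rewrite ltnS; case: (leqP i m) => //= mi; move/hasPn: gap => /(_ i).
    rewrite mem_iota; move: fi; rewrite take_nseq; last by lia.
    by move=> ->; lia.
  by move=> /andP[_ /eqP->]; rewrite ltnSn orbT.
have [j [jp s0 s1 s2 sn]] := block_around ss mn.
have /sP : nth 0 s j.+1 \in s.
  by apply: mem_nth; have /and4P[/eqP -> _ _ _] := ss.
have := bottleneck_block jp s0 sn; lia.
Qed.

Lemma size_placed_ones f n :
  size (placed f (nseq n 1)) = count (fun i => f (nseq i 1)) (iota 1 n).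
Proof.
rewrite size_map size_filter size_nseq; apply: eq_in_count => i.
by rewrite mem_iota => ?; rewrite take_nseq //; lia.
Qed.

(** The intervals are disjoint and each one hit contains a separator, so all hits are paid for by
    the separators of the single longest input. *)
Lemma sum_hits_le f p K :
  \sum_(k < K) hits f (p * 2 ^ k) (p * 2 ^ k.+1)
    <= size (placed f (nseq (p * 2 ^ K) 1)).
Proof.
rewrite size_placed_ones; elim: K => [|K IH]; first by rewrite big_ord0.
rewrite big_ord_recr /=.
have -> : p * 2 ^ K.+1 = p * 2 ^ K + p * 2 ^ K by rewrite expnS; lia.
rewrite iotaD count_cat leq_add // /hits addnK add1n.
by rewrite has_count; case: (count _ _).
Qed.

Section Randomized.
Variables (R : realType) (p : nat).
Local Open Scope ring_scope.

Lemma ratio_ge0 (D : det_alg p) w : 0 <= Defs.ratio R D w.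
Proof. by rewrite /Defs.ratio divr_ge0. Qed.

Lemma ratio_ones_gap (D : det_alg p) k : (0 < p)%N ->
  ~~ hits D (p * 2 ^ k) (p * 2 ^ k.+1) ->
  p%:R / 2 <= Defs.ratio R D (nseq (p * 2 ^ k.+1) 1%N).
Proof.
move=> p0 gap; rewrite /Defs.ratio.
have := bottleneck_ones_gap p0 _ gap; rewrite expnS.
set b := bottleneck _ _ _ => bgap.
have {bgap} : (p * 2 ^ k <= b)%N by lia.
have := opt_ones_le p (2 ^ k.+1); rewrite expnS.
have : (0 < opt p (nseq (p * (2 * 2 ^ k)) 1))%N.
  by apply: opt_ones_gt0; rewrite // !muln_gt0 p0 expn_gt0.
move: (opt _ _) => o o0 oe be.
rewrite ler_pdivlMr ?ltr0n // mulrAC ler_pdivrMr // -!natrM ler_nat.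
by apply: leq_trans (leq_mul (leqnn p) oe) _; lia.
Qed.

Lemma sum_ratio_ge (D : det_alg p) : (0 < p)%N ->
  p%:R * (p%:R / 2)
    <= \sum_(k < 2 * p) Defs.ratio R D (nseq (p * 2 ^ k.+1) 1%N).
Proof.
move=> p0; pose h (k : nat) := hits D (p * 2 ^ k) (p * 2 ^ k.+1).
have budget : (\sum_(k < 2 * p) h k <= p)%N.
  apply: leq_trans (sum_hits_le _ _ _) _.
  apply: leq_trans (decide_budget D _) (leq_pred p).
  by apply: nseq_inputs; rewrite muln_gt0 p0 expn_gt0.
have : (p <= \sum_(k < 2 * p) ~~ h k)%N.
  have : (\sum_(k < 2 * p) (h k + ~~ h k) = 2 * p)%N.
    rewrite (eq_bigr (fun=> 1%N)); last by move=> k _; case: (h k).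
    by rewrite sum_nat_const card_ord muln1.
  rewrite big_split /=; move: budget => /=; lia.
rewrite -(ler_nat R) => misses.
(* Each missed interval contributes [p / 2]; the ratio at a hit one is bounded below by 0. *)
apply: le_trans (ler_wpM2r _ misses) _; first by rewrite divr_ge0.
rewrite natr_sum mulr_suml; apply: ler_sum => k _.
have [hk|gap] := boolP (h k); first by rewrite mul0r ratio_ge0.
by rewrite mul1r ratio_ones_gap.
Qed.

(** Finitely many measurable bits take finitely many values, so [F] can be arbitrary. The induction
    branches on the first bit and absorbs it into [F]. *)
Lemma measurable_map_decisions d (T : measurableType d) (A : rand_alg p T)
    (ws : seq (seq nat)) (F : seq bool -> R) :
  (forall w, w \in ws -> inputs w) ->
  measurable_fun setT (fun t => F [seq decide (A t) w | w <- ws]).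
Proof.
elim: ws F => [|w ws IH] F wsI; first by rewrite /=; exact: measurable_cst.
have wsI' v : v \in ws -> inputs v by move=> vs; apply: wsI; rewrite inE vs orbT.
rewrite (_ : (fun t => _) = (fun t => if decide (A t) w
    then F (true :: [seq decide (A t) v | v <- ws])
    else F (false :: [seq decide (A t) v | v <- ws]))); last first.
  by apply/funext => t /=; case: (decide _ w).
apply: measurable_fun_ifT.
- apply: (measurable_fun_bool true); rewrite setTI.
  rewrite (_ : _ @^-1` _ = [set t | decide (A t) w])%classic.
    by apply: run_measurable; apply: wsI; rewrite mem_head.
  by apply/seteqP; split => t.
- exact: (IH (fun u => F (true :: u))).
- exact: (IH (fun u => F (false :: u))).
Qed.

Lemma measurable_ratio d (T : measurableType d) (A : rand_alg p T) w :
  inputs w -> measurable_fun setT (fun t => Defs.ratio R (A t) w).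
Proof.
move=> [_ wpos].
(* The ratio factors through the decisions on the nonempty prefixes of [w]: [pl] rebuilds the
   separators from these bits. *)
pose ws := [seq take i w | i <- iota 1 (size w)].
pose pl (u : seq bool) := [seq i.+1 | i <- mask u (iota 1 (size w))].
pose F u := (bottleneck p w
  (1%N :: pl u ++ nseq (p - size (pl u)) (size w).+1))%:R / (opt p w)%:R : R.
rewrite (_ : (fun t => _) = (fun t => F [seq decide (A t) v | v <- ws])).
  apply: measurable_map_decisions => v /mapP[i].
  rewrite mem_iota => /andP[i1 iw] ->; split.
    rewrite -size_eq0 -lt0n size_take; case: ifP => // _.
    exact: leq_trans i1 iw.
  by apply/allP => x /mem_take; move/allP: wpos; apply.
by apply/funext => t; rewrite /Defs.ratio /alg_separators /placed filter_mask -map_comp.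
Qed.

End Randomized.

Lemma competitive_ratio_ones_ge (R : realType) p d (T : measurableType d)
    (P : probability T R) (A : rand_alg p T) : 0 < p ->
  ((4^-1 * p%:R)%:E <= competitive_ratio P A all_ones)%E.
Proof.
move=> p0; set S := competitive_ratio _ _ _.
pose w k := nseq (p * 2 ^ k.+1) 1.
have wI k : all_ones (w k) by exists (p * 2 ^ k.+1); rewrite // muln_gt0 p0 expn_gt0.
pose E k := (\int[P]_t (Defs.ratio R (A t) (w k))%:E)%E.
have ES k : (E k <= S)%E.
  apply: ereal_sup_ubound; exists (w k) => //.
  by rewrite expectation.unlock.
have E0 k : (0 <= E k)%E.
  by apply: integral_ge0 => t _; rewrite lee_fin ratio_ge0.
have mE k : measurable_fun setT (EFin \o fun t => Defs.ratio R (A t) (w k)).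
  by apply/measurable_EFinP/measurable_ratio/all_ones_inputs.
have sumE : ((p%:R * (p%:R / 2))%:E <= \sum_(k < 2 * p) E k)%E.
  rewrite -ge0_integral_sum //; last 2 first.
  - by move=> k; exact: mE.
  - by move=> k t _; rewrite lee_fin ratio_ge0.
  (* As [P] has total mass 1, the pointwise bound is its own integral. *)
  rewrite -[leLHS]mule1 -(probability_setT P) -integral_cst //.
  apply: ge0_le_integral => //.
  - by move=> t _; rewrite lee_fin mulr_ge0 ?divr_ge0.
  - exact: (emeasurable_sum _ (fun k : 'I_(2 * p) => mE k)).
  - by move=> t _; rewrite sumEFin lee_fin sum_ratio_ge.
(* Nonnegativity excludes [-oo]. For finite [S = r], the [2 * p] expectations give
   [p * (p / 2) <= 2 * p * r], whence the constant [1 / 4]. *)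
have := le_trans (E0 0) (ES 0); move: ES; case: S => [r||] //= ES _; last first.
  by rewrite leey.
have {sumE} := le_trans sumE (lee_sum _ (fun (k : 'I_(2 * p)) _ => ES k)).
rewrite sumEFin !lee_fin sumr_const card_ord -(mulr_natl r) natrM.
have : (0 < p%:R :> R)%R by rewrite ltr0n.
move: (p%:R)%R => x x0 le_sum; nra.
Qed.

Theorem theorem1 (R : realType) :
  exists2 c : R, (0 < c)%R &
    forall (p : nat), 2 <= p ->
    forall (d : measure_display) (T : measurableType d) (P : probability T R)
           (A : rand_alg p T),
      ((c * p%:R)%:E <= competitive_ratio P A inputs)%E /\
      ((c * p%:R)%:E <= competitive_ratio P A all_ones)%E.
Proof.
exists (4^-1)%R; first by rewrite invr_gt0.
move=> p p2 d T P A.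
have ones := competitive_ratio_ones_ge P A (ltnW p2).
split=> //; apply: le_trans ones _; apply: ereal_sup_le.
exact/image_subset/all_ones_inputs.
Qed.
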